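(* Assume $X_0\in L^\infty$. Then $\inf\{\int_0^1Q(s)Q_\rho(1-s)ds : Q\in\mathscr{Q},\ Q\succeq_{\mathrm{icx}}Q_0\}=-\infty$.
   Context: $(\Omega,\mathcal{F},\mathbb{P})$ is a complete nonatomic probability space. $\rho\in L^2$ with $\mathbb{P}(\rho>0)=1$ and $\mathrm{Var}[\rho]>0$. For a random variable $X$, $Q_X(t)=\inf\{y\in\mathbb{R}:\mathbb{P}(X\le y)>t\}$, $t\in[0,1)$, and $Q_0:=Q_{X_0}$. $\mathscr{Q}$ is the set of increasing, right-continuous $Q:[0,1)\to\mathbb{R}$ with $\int_0^1Q^2(s)ds<\infty$. For $Q_1,Q_2\in\mathscr{Q}$, $Q_1\succeq_{\mathrm{icx}}Q_2$ means $\int_t^1Q_1(s)ds\ge\int_t^1Q_2(s)ds$ for all $t\in[0,1]$. *)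

(* Defs.v *)
From HB Require Import structures.
From mathcomp Require Import all_boot all_order all_algebra.
From mathcomp Require Import all_classical all_reals all_analysis.
Set Implicit Arguments. Unset Strict Implicit. Unset Printing Implicit Defensive.
Import Order.TTheory GRing.Theory Num.Theory.
Import numFieldNormedType.Exports.
Local Open Scope classical_set_scope.
Local Open Scope ring_scope.

Definition nonatomic d (T : measurableType d) (R : realType)
    (P : {measure set T -> \bar R}) : Prop :=
  forall A, measurable A -> (0 < P A)%E ->
    exists2 B, measurable B /\ B `<=` A & (0 < P B)%E /\ (P B < P A)%E.

(** Quantile function Q_X(t) = inf { y in R : P(X <= y) > t }, meant for t in [0,1). *)
Definition quantile d (T : measurableType d) (R : realType)
    (P : probability T R) (X : T -> R) (t : R) : R :=
  inf [set y : R | (t%:E < P [set w | (X w <= y)%R])%E].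

Definition quantile_class (R : realType) (Q : R -> R) : Prop :=
  [/\ (forall s t : R, 0 <= s -> s <= t -> t < 1 -> Q s <= Q t),
      (forall t : R, 0 <= t -> t < 1 -> Q x @[x --> t^'+] --> Q t) &
      (@lebesgue_measure R).-integrable `[0, 1[ (fun s => ((Q s) ^+ 2)%:E)].

Definition icx_ge (R : realType) (Q1 Q2 : R -> R) : Prop :=
  forall t : R, 0 <= t -> t <= 1 ->
    (\int[@lebesgue_measure R]_(s in `[t, 1%R[) (Q2 s)%:E
      <= \int[@lebesgue_measure R]_(s in `[t, 1%R[) (Q1 s)%:E)%E.

(* Main.v *)
Require Import Defs.
From HB Require Import structures.
From mathcomp Require Import all_boot all_order all_algebra.
From mathcomp Require Import all_classical all_reals all_analysis.
From mathcomp Require Import measurable_realfun ess_sup_inf.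
From mathcomp Require Import lra.
Import Order.TTheory GRing.Theory Num.Theory.
Import numFieldNormedType.Exports.
Local Open Scope classical_set_scope.
Local Open Scope ring_scope.

(** Let [M] bound [|Q_{X_0}|] on [(0, 1)] and let [Q] be equal to [M - k] on
    [[0, 1/2)] and to [M + k] on [[1/2, 1)]. Its tail integrals dominate
    those of the constant [M], hence those of [Q_{X_0}]. With
    [g s = Q_rho (1 - s)], [A] the integral of [g] over [[0, 1/2)] and [B] its
    integral over [[1/2, 1)], the cost of [Q] is [(M + k) B - (k - M) A]. Since
    [g] is nonnegative, nonincreasing and not constant ([Var rho > 0]), [B < A],
    so the cost tends to [-oo] as [k] grows. If [A = +oo] the cost is already
    [-oo], so the integrability of [Q_rho] plays no role. *)

(** Within [D], the preimage of a ray [[r, +oo[] is order-convex, hence an interval. Monotonicity on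
    [D] alone suits quantile functions, which are controlled only inside []0, 1[]. *)
Lemma nondecreasing_in_measurable (R : realType) (D : set R) (f : R -> R) :
  is_interval D -> (forall s t, D s -> D t -> s <= t -> f s <= f t) ->
  measurable_fun D f.
Proof.
move=> iD ndf mD.
apply: (measurability _ (measurable_realfun.RGenCInfty.measurableE R)) => //.
move=> _ [_] [r ->] <-; apply: is_interval_measurable => s t /=.
rewrite !in_itv/= !andbT => -[Ds fs] [Dt ft] u /andP[su ut].
have Du : D u by apply: (iD s t) => //; rewrite su.
by split => //; rewrite in_itv/= andbT (le_trans fs)// ndf.
Qed.

(** * Quantile functions and the cdf *)

Section quantile.
Context {R : realType} {d : measure_display} {Omega : measurableType d}.
Variables (P : probability Omega R) (X : {RV P >-> R}).
Implicit Types s t y : R.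

Let cdfE y : P [set w | X w <= y] = cdf X y.
Proof. by congr (P _); apply/seteqP; split => w /=; rewrite in_itv. Qed.

(** As the cdf is nondecreasing, each [z] in the defining set lies above [y]. Since the cdf tends to
    1 and [t < 1], this set is nonempty, so [inf] is a genuine infimum. *)
Lemma quantile_ge t y :
  t < 1 -> (P [set w | (X w <= y)%R] <= t%:E)%E -> y <= quantile P X t.
Proof.
move=> t1; rewrite cdfE => Fy; apply: lb_le_inf.
  apply/not_existsP => Ft; have : (1 <= t%:E)%E.
    apply: cvge_to_le (cvg_cdfy1 X) _; apply: nearW => z.
    by have /negP := Ft z; rewrite -leNgt cdfE.
  by rewrite lee_fin leNgt t1.
move=> z /=; rewrite cdfE => tz; rewrite leNgt; apply/negP => zy.
by have := cdf_nondecreasing X (ltW zy); rewrite leNgt (le_lt_trans Fy).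
Qed.

(** Here [0 < t] bounds the defining set below, because the cdf tends to 0 at [-oo]. *)
Lemma quantile_le t y :
  0 < t -> (t%:E < P [set w | (X w <= y)%R])%E -> quantile P X t <= y.
Proof.
move=> t0 ty; apply: ge_inf => //.
have [z zt] : exists z, (cdf X z < t%:E)%E.
  apply/not_existsP => Ft; have : (t%:E <= 0)%E.
    apply: cvge_to_ge (cvg_cdfNy0 X) _; apply: nearW => z.
    by have /negP := Ft z; rewrite -leNgt.
  by rewrite lee_fin leNgt t0.
exists z => x /=; rewrite cdfE => tx; rewrite leNgt; apply/negP => xz.
by have := cdf_nondecreasing X (ltW xz); rewrite leNgt (lt_trans zt).
Qed.

Lemma quantile_nondecreasing s t :
  0 < s -> s <= t -> t < 1 -> quantile P X s <= quantile P X t.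
Proof.
move=> s0 st t1; rewrite leNgt; apply/negP => qts.
pose y := (quantile P X t + quantile P X s) / 2.
have [qty yqs] : quantile P X t < y /\ y < quantile P X s.
  by rewrite /y; split; lra.
have [/(quantile_ge _ _ t1)|ty] := leP (P [set w | X w <= y]) t%:E.
  by rewrite leNgt qty.
have /(quantile_le _ _ s0) : (s%:E < P [set w | (X w <= y)%R])%E.
  by rewrite (le_lt_trans _ ty)// lee_fin.
by rewrite leNgt yqs.
Qed.

Lemma measurable_quantile :
  measurable_fun (`]0, 1[%classic : set R) (quantile P X).
Proof.
apply: nondecreasing_in_measurable; first exact: interval_is_interval.
move=> s t; rewrite /= !in_itv/= => /andP[s0 _] /andP[_ t1] st.
exact: quantile_nondecreasing.
Qed.

(** By contraposition: if no such [s] exists, monotonicity squeezes the quantile function to a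
    constant [c] on []0, 1[]. The cdf then jumps from 0 to 1 at [c], so [X = c] almost everywhere
    and the variance vanishes. *)
Lemma quantile_lt_of_variance_gt0 : (0 < 'V_P[X])%E ->
  exists2 s, 0 < s < 2^-1 & quantile P X s < quantile P X (1 - s).
Proof.
apply: contraPP => /forall2NP qconst.
pose c := quantile P X (2^-1).
have qc s : 0 < s < 2^-1 -> quantile P X s = c /\ quantile P X (1 - s) = c.
  move=> s2; have [s0 slt] := andP s2.
  have [//|/negP] := qconst s; rewrite -leNgt => q1.
  have q2 : quantile P X s <= c by apply: quantile_nondecreasing; lra.
  have q3 : c <= quantile P X (1 - s) by apply: quantile_nondecreasing; lra.
  by split; lra.
have mX y : measurable [set w | X w <= y].
  by rewrite -[X in measurable X]setTI; exact: measurable_fun_le.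
have Flt y : y < c -> P [set w | X w <= y] = 0%E.
  move=> yc; apply/eqP; rewrite eq_le measure_ge0 andbT.
  apply/lee_addgt0Pr => e e0; rewrite add0e.
  (* The cap [4^-1] keeps [s] below [2^-1], where [qc] applies, while [s <= e]. *)
  pose s := Num.min e 4^-1.
  have s2 : 0 < s < 2^-1.
    rewrite lt_min gt_min e0 invr_gt0 ltr0n/=; apply/orP; right; lra.
  apply: (@le_trans _ _ s%:E); last by rewrite lee_fin ge_min lexx.
  rewrite leNgt; apply/negP => Fy; have /andP[s0 _] := s2.
  by have := quantile_le _ _ s0 Fy; rewrite (qc _ s2).1 leNgt yc.
have Fgt y : c < y -> P [set w | X w <= y] = 1%E.
  move=> cy; apply/eqP; rewrite eq_le probability_le1//=.
  apply/lee_addgt0Pr => e e0.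
  pose s := Num.min e 4^-1.
  have s2 : 0 < s < 2^-1.
    rewrite lt_min gt_min e0 invr_gt0 ltr0n/=; apply/orP; right; lra.
  have se : s <= e by rewrite ge_min lexx.
  rewrite -leeBlDr// -EFinB; apply: (@le_trans _ _ (1 - s)%:E).
    by rewrite lee_fin; lra.
  rewrite leNgt; apply/negP => /ltW Fy; have /andP[s0 _] := s2.
  have : y <= quantile P X (1 - s) by apply: quantile_ge Fy; lra.
  by rewrite (qc _ s2).2 leNgt cy.
have Xc : {ae P, forall w, X w = c}.
  (* The cdf is known only off [c], so [X] is first confined to shrinking intervals around [c], and
     countably many null sets are then combined. *)
  have inv_gt0 n : 0 < n.+1%:R^-1 :> R by rewrite invr_gt0.
  have XcN n : {ae P, forall w, c - n.+1%:R^-1 < X w <= c + n.+1%:R^-1}.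
    have lo : {ae P, forall w, c - n.+1%:R^-1 < X w}.
      exists [set w | X w <= c - n.+1%:R^-1]; split => //.
        by apply: Flt; rewrite ltrBlDr ltrDl.
      by move=> w /negP; rewrite -leNgt.
    have hi : {ae P, forall w, X w <= c + n.+1%:R^-1}.
      exists (~` [set w | X w <= c + n.+1%:R^-1]); split => //.
        exact: measurableC.
      by rewrite probability_setC// Fgt ?subee// ltrDl.
    by apply: filterS2 lo hi => w -> ->.
  have /ae_foralln := XcN; apply: filterS => w Xw; apply/eqP; rewrite eq_le.
  apply/andP; split; apply/ler_addgt0Pr => e e0;
    have [n _ /(_ n (leqnn n)) /= /ltW ne] := near_infty_natSinv_lt (PosNum e0);
    have /andP[/ltW lo hi] := Xw n.
    by rewrite (le_trans hi)// lerD2l.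
  by rewrite -lerBlDr (le_trans _ lo)// lerD2l lerN2.
have EX : ('E_P[X] = c%:E)%E.
  rewrite -(expectation_cst P c) unlock; apply: ae_eq_integral => //.
  - exact/measurable_EFinP.
  - exact/measurable_EFinP.
  - by apply: filterS Xc => w /= ->.
rewrite /variance unlock EX/= unlock (ae_eq_integral (cst 0%E))//.
- by rewrite integral_cst// mul0e ltxx.
- by apply/measurable_EFinP; apply: measurable_funM; exact: measurable_funB.
- by apply: filterS Xc => w /= Xw _; rewrite fctE/= Xw subrr mul0r.
Qed.
End quantile.

(** * Integrals over subintervals and comparison of the two halves *)

Section interval_integrals.
Context {R : realType}.
Notation mu := (@lebesgue_measure R).
Implicit Types (a b c m : R).

Lemma integral_itv_cst (x y : bool) a b c : a <= b ->
  (\int[mu]_(s in [set` Interval (BSide x a) (BSide y b)]) c%:E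
   = (c * (b - a))%:E)%E.
Proof.
move=> ab; have := @integral_cst _ _ _ mu
  [set` Interval (BSide x a) (BSide y b)] (measurable_itv _) c%:E.
rewrite /= => ->; rewrite lebesgue_measure_itv/= lte_fin.
case: ltgtP ab => [ab _|//|-> _]; first by rewrite -EFinB -EFinM.
by rewrite mule0 subrr mulr0.
Qed.

Lemma integral_itv_split a m b (f : R -> \bar R) : a <= m -> m <= b ->
  measurable_fun (`]a, b[%classic : set R) f ->
  (\int[mu]_(s in `[a, b[) f s
   = \int[mu]_(s in `[a, m[) f s + \int[mu]_(s in `[m, b[) f s)%E.
Proof.
move=> am mb /emeasurable_fun_itv_obnd_cbndP mf.
have abE : `[a, b[%classic = `[a, m[%classic `|` `[m, b[%classic :> set R.
  by apply: itv_bndbnd_setU; rewrite bnd_simp.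
rewrite abE integral_setU//; first by rewrite -abE.
apply/disj_setPRL => s /=; rewrite !in_itv/= => /andP[ms _] /andP[_ sm].
by move: sm; rewrite ltNge ms.
Qed.

(** With [0 <= c] both integrands are nonnegative on the open interval, so the comparison also
    covers an infinite integral of [g]. *)
Lemma ge_integral_itv (x y : bool) a b c (g : R -> R) : a <= b ->
  measurable_fun (`]a, b[%classic : set R) g -> 0 <= c ->
  (forall s, a < s < b -> c <= g s) ->
  ((c * (b - a))%:E
   <= \int[mu]_(s in [set` Interval (BSide x a) (BSide y b)]) (g s)%:E)%E.
Proof.
move=> ab mg c0 cg; rewrite integral_itv_bndoo; last exact/measurable_EFinP.
rewrite -(integral_itv_cst false true _ _ c ab); apply: ge0_le_integral => //=.
exact/measurable_EFinP.
Qed.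

Lemma le_integral_itv (x y : bool) a b c (g : R -> R) : a <= b ->
  measurable_fun (`]a, b[%classic : set R) g ->
  (forall s, a < s < b -> 0 <= g s <= c) ->
  (\int[mu]_(s in [set` Interval (BSide x a) (BSide y b)]) (g s)%:E
   <= (c * (b - a))%:E)%E.
Proof.
move=> ab mg gc; rewrite integral_itv_bndoo; last exact/measurable_EFinP.
rewrite -(integral_itv_cst false true _ _ c ab); apply: ge0_le_integral => //=.
- by move=> s; rewrite in_itv/= lee_fin => /gc /andP[].
- by apply/measurable_EFinP.
- by move=> s; rewrite in_itv/= lee_fin => /gc /andP[].
Qed.

(** Cut at [s0], [2^-1] and [1 - s0], and let [c = g 2^-1]. The left half is at least
    [g s0 * s0 + c * (2^-1 - s0)], the right half at most [c * (2^-1 - s0) + g (1 - s0) * s0]. The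
    gap [s0 * (g s0 - g (1 - s0))] is positive, and the finite upper bound keeps the inequality
    strict even if the left integral is infinite. *)
Lemma integral_nonincreasing_halves_lt (g : R -> R) (s0 : R) :
  measurable_fun (`]0, 1[%classic : set R) g ->
  (forall s, 0 < s < 1 -> 0 <= g s) ->
  (forall s t, 0 < s -> s <= t -> t < 1 -> g t <= g s) ->
  0 < s0 < 2^-1 -> g (1 - s0) < g s0 ->
  (\int[mu]_(s in `[2^-1%R, 1%R[) (g s)%:E
   < \int[mu]_(s in `[0%R, 2^-1%R[) (g s)%:E)%E.
Proof.
move=> mg g0 gni /andP[s00 s02] gs0.
have mgS a b : 0 <= a -> b <= 1 -> measurable_fun (`]a, b[%classic : set R) g.
  move=> a0 b1; apply: measurable_funS mg => // s /=; rewrite !in_itv/=.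
  by move=> /andP[? ?]; apply/andP; split; lra.
have mgE a b : 0 <= a -> b <= 1 ->
    measurable_fun (`]a, b[%classic : set R) (EFin \o g).
  by move=> a0 b1; apply/measurable_EFinP; exact: mgS.
pose c := g 2^-1.
rewrite (integral_itv_split 0 s0); [|lra|lra|by apply: mgE; lra].
rewrite (integral_itv_split 2^-1 (1 - s0)); [|lra|lra|by apply: mgE; lra].
have A1 := @ge_integral_itv true true 0 s0 (g s0) g.
have A2 := @ge_integral_itv true true s0 2^-1 c g.
have B1 := @le_integral_itv true true 2^-1 (1 - s0) c g.
have B2 := @le_integral_itv true true (1 - s0) 1 (g (1 - s0)) g.
apply: (@le_lt_trans _ _
  (c * (1 - s0 - 2^-1) + g (1 - s0) * (1 - (1 - s0)))%:E).
  rewrite EFinD; apply: leeD.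
  - apply: B1 => [||s /andP[? ?]]; [lra|by apply: mgS; lra|].
    by rewrite g0 ?gni//; lra.
  - apply: B2 => [||s /andP[? ?]]; [lra|by apply: mgS; lra|].
    by rewrite g0 ?gni//; lra.
apply: (@lt_le_trans _ _ (g s0 * (s0 - 0) + c * (2^-1 - s0))%:E).
  by rewrite lte_fin; nra.
rewrite EFinD; apply: leeD.
- apply: A1 => [|||s /andP[? ?]]; [lra|by apply: mgS; lra|by apply: g0; lra|].
  by rewrite gni//; lra.
- apply: A2 => [|||s /andP[? ?]]; [lra|by apply: mgS; lra|by apply: g0; lra|].
  by rewrite gni//; lra.
Qed.

End interval_integrals.

(** * The two-valued competitors: admissibility and cost *)

Section step_quantile.
Context {R : realType}.
Notation mu := (@lebesgue_measure R).
Implicit Types (M k : R).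

Definition step_quantile M k (s : R) : R := if s < 2^-1 then M - k else M + k.

Lemma step_quantile_nondecreasing M k : 0 <= k ->
  {homo step_quantile M k : s t / s <= t}.
Proof.
by move=> k0 s t st; rewrite /step_quantile; do 2 case: ltP => ?; lra.
Qed.

Lemma measurable_step_quantile M k (D : set R) : 0 <= k -> measurable D ->
  measurable_fun D (step_quantile M k).
Proof.
by move=> k0 mD; apply: nondecreasing_measurable => //;
  exact: step_quantile_nondecreasing.
Qed.

Lemma quantile_class_step M k : 0 <= k -> quantile_class (step_quantile M k).
Proof.
move=> k0; split.
- by move=> s t _ st _; exact: step_quantile_nondecreasing.
- move=> t _ _.
  (* The strict test [s < 2^-1] puts the jump point in the upper piece, so the function is constant
     just to the right of every [t]. *)
  have: \forall x \near t^'+, step_quantile M k x = step_quantile M k t.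
    rewrite /step_quantile; case: (ltP t 2^-1) => [t2|t2]; near=> x.
      by rewrite ifT//; near: x; exact: nbhs_right_lt.
    by rewrite ifF//; apply/negbTE; rewrite -leNgt (le_trans t2)// ltW//.
  exact: cvg_near_cst.
- apply: measurable_bounded_integrable => //.
  + by rewrite /= lebesgue_measure_itv/= lte01 oppr0 adde0 ltry.
  + by apply: measurable_funX; exact: measurable_step_quantile.
  + exists ((`|M| + `|k|) ^+ 2); split; first exact: num_real.
    move=> B MB s _; rewrite /= normrX (le_trans _ (ltW MB))//.
    rewrite ler_pXn2r ?nnegrE//.
    by rewrite /step_quantile; case: ifP => _; rewrite ?ler_normD ?ler_normB.
Unshelve. all: by end_near. Qed.

(** The excess over the constant [M] integrates to [k * (1 - t)] if [2^-1 <= t] and to [k * t]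
    otherwise; both are nonnegative. *)
Lemma integral_step_quantile_ge M k t : 0 <= k -> 0 <= t -> t <= 1 ->
  ((M * (1 - t))%:E
   <= \int[mu]_(s in `[t, 1%R[) (step_quantile M k s)%:E)%E.
Proof.
move=> k0 t0 t1.
have half_r a : 2^-1 <= a -> a <= 1 ->
    (\int[mu]_(s in `[a, 1%R[) (step_quantile M k s)%:E
     = ((M + k) * (1 - a))%:E)%E.
  move=> a2 a1; rewrite -(integral_itv_cst true true _ _ _ a1).
  apply: eq_integral => s; rewrite inE/= in_itv/= => /andP[as_ _].
  by rewrite /step_quantile ltNge (le_trans a2).
have [t2|t2] := leP 2^-1 t.
  by rewrite half_r// lee_fin ler_wpM2r//; lra.
have half_l : (\int[mu]_(s in `[t, 2^-1%R[) (step_quantile M k s)%:E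
     = ((M - k) * (2^-1 - t))%:E)%E.
  rewrite -(integral_itv_cst true true _ _ _ (ltW t2)).
  apply: eq_integral => s; rewrite inE/= in_itv/= => /andP[_ s2].
  by rewrite /step_quantile s2.
rewrite (integral_itv_split t 2^-1); [|lra|lra|]; last first.
  by apply/measurable_EFinP; exact: measurable_step_quantile.
by rewrite half_l half_r ?lexx//; [rewrite -EFinD lee_fin; nra|lra].
Qed.

(** The constant [M] serves as intermediary: it dominates [Q] pointwise on []0, 1[], and its tail
    integrals are dominated by those of the step. As [Q] may change sign, the bound on its absolute
    value also supplies integrability. *)
Lemma icx_ge_step_quantile M k (Q : R -> R) : 0 <= k ->
  measurable_fun (`]0, 1[%classic : set R) Q ->
  (forall s, 0 < s < 1 -> `|Q s| <= M) ->
  icx_ge (step_quantile M k) Q.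
Proof.
move=> k0 mQ QM t t0 t1.
apply: le_trans (integral_step_quantile_ge M k t k0 t0 t1).
have mQt : measurable_fun (`]t, 1[%classic : set R) Q.
  by apply: measurable_funS mQ => //; apply: subset_itvr; rewrite bnd_simp.
rewrite integral_itv_bndoo; last exact/measurable_EFinP.
rewrite -(integral_itv_cst false true _ _ M t1).
have mut : (mu `]t, 1%R[ < +oo)%E.
  rewrite /= lebesgue_measure_itv/=; case: ifP => _; by rewrite ?ltry// -EFinB ltry.
have QMt s : (`]t, 1[%classic : set R) s -> `|Q s| <= M.
  by rewrite /= in_itv/= => /andP[ts s1]; apply: QM; lra.
apply: le_integral => //.
- apply: measurable_bounded_integrable => //.
  exists M; split; first exact: num_real.
  by move=> B MB s /QMt QsM /=; rewrite (le_trans QsM)// ltW.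
- apply: measurable_bounded_integrable => //; exact: bounded_cst.
- by move=> s; rewrite inE => /QMt QsM; rewrite lee_fin (le_trans (ler_norm _)).
Qed.

(** The condition [|M| <= k] makes [M + k] and [k - M] nonnegative. The integrand thus has constant
    sign on each half, and the constants can be pulled out of possibly infinite integrals. *)
Lemma integral_step_quantileM M k (g : R -> R) :
  `|M| <= k -> measurable_fun (`]0, 1[%classic : set R) g ->
  (forall s, 0 <= s < 1 -> 0 <= g s) ->
  (\int[mu]_(s in `[0%R, 1%R[) (step_quantile M k s * g s)%:E
   = (M + k)%:E * \int[mu]_(s in `[2^-1%R, 1%R[) (g s)%:E
     - (k - M)%:E * \int[mu]_(s in `[0%R, 2^-1%R[) (g s)%:E)%E.
Proof.
rewrite ler_norml => /andP[Mk kM] mg g0; have k0 : 0 <= k by lra.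
have mgS a b : 0 <= a -> b <= 1 -> measurable_fun (`[a, b[%classic : set R) g.
  move=> a0 b1; move/measurable_fun_itv_obnd_cbndP: mg.
  apply: measurable_funS => // s /=; rewrite !in_itv/=.
  by move=> /andP[? ?]; apply/andP; split; lra.
rewrite (integral_itv_split 0 2^-1); [|lra|lra|]; last first.
  apply/measurable_EFinP; apply: measurable_funM => //.
  exact: measurable_step_quantile.
rewrite addeC; congr (_ + _)%E.
  rewrite -ge0_integralZl_EFin//; last 3 first.
  - by move=> s; rewrite /= in_itv/= => /andP[? ?]; rewrite lee_fin g0//; lra.
  - by apply/measurable_EFinP; apply: mgS; lra.
  - by lra.
  apply: eq_integral => s; rewrite inE/= in_itv/= => /andP[s2 _].
  by rewrite /step_quantile ltNge s2 EFinM.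
rewrite -ge0_integralZl_EFin//; last 3 first.
- by move=> s; rewrite /= in_itv/= => /andP[? ?]; rewrite lee_fin g0//; lra.
- by apply/measurable_EFinP; apply: mgS; lra.
- by lra.
rewrite -integral_ge0N; last first.
  move=> s; rewrite /= in_itv/= => /andP[? ?].
  by rewrite lee_fin mulr_ge0// ?g0//; lra.
apply: eq_integral => s; rewrite inE/= in_itv/= => /andP[_ s2].
by rewrite /step_quantile s2 -mulNr opprB.
Qed.

End step_quantile.

(** Since [B < A], [B] is finite. For finite [A] the expression is affine in [k] with slope
    [B - A < 0]; for [A = +oo] it equals [-oo] as soon as [k > M]. *)
Lemma exists_affine_combination_le (R : realType) (A B : \bar R) (M r : R) :
  (0 <= B)%E -> (B < A)%E ->
  exists2 k : R, `|M| < k & ((M + k)%:E * B - (k - M)%:E * A <= r%:E)%E.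
Proof.
case: B => [b| |]; case: A => [a| |] //; rewrite ?lee_fin ?lte_fin.
(* [k0] is the value of [k] at which the expression equals [r]; any larger [k] also works, so it can
   be taken above [|M|]. *)
- move=> b0 ba; pose k0 := (M * (a + b) - r) / (a - b).
  exists (`|M| + 1 + `|k0|); first by have := normr_ge0 k0; lra.
  rewrite -!EFinM -EFinB lee_fin.
  have ab0 : 0 < a - b by lra.
  have kk0 : k0 * (a - b) = M * (a + b) - r by rewrite divfK// gt_eqF.
  have := ler_norm k0; have := normr_ge0 M; nra.
- move=> b0 _; exists (`|M| + 1); first by rewrite ltrDl ltr01.
  rewrite gt0_muley; last by rewrite lte_fin; have := ler_norm M; lra.
  by rewrite -EFinM addeNy leNye.
Qed.

(** * From essential boundedness to the theorem *)

Lemma Lfunoo_ae_bounded (R : realType) (d : measure_display)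
    (T : measurableType d) (P : probability T R) (X : T -> R) :
  X \in Lfun P +oo%E -> exists2 M : R, 0 <= M & {ae P, forall w, `|X w| <= M}.
Proof.
move=> /andP[_]; rewrite inE/= /finite_norm unlock/= probability_setT lte01.
move=> /(ess_supr_bounded (f := Num.norm \o X)) [M XM].
exists `|M| => //; apply: filterS XM => w /= /le_trans; apply; exact: ler_norm.
Qed.

Theorem theorem4p1 (R : realType) (d : measure_display) (Omega : measurableType d)
    (P : probability Omega R) (X0 rho : Omega -> R) :
  measure_is_complete P ->
  nonatomic P ->
  rho \in Lfun P 2%:E ->
  P [set w | 0 < rho w] = 1%E ->
  (0 < 'V_P[rho])%E ->
  X0 \in Lfun P +oo%E ->
  (ereal_inf [set \int[@lebesgue_measure R]_(s in `[0%R, 1%R[)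
                    ((Q s * quantile P rho (1 - s))%R)%:E
             | Q in [set Q : R -> R | quantile_class Q /\ icx_ge Q (quantile P X0)]]
   = -oo)%E.
Proof.
move=> _ _ rho2 rho0 Vrho X0b.
have [M M0 X0M] := Lfunoo_ae_bounded _ _ _ _ _ X0b.
have mrho : measurable_fun setT rho by have /sub_Lfun_mfun := rho2; rewrite inE.
have mX0 : measurable_fun setT X0 by have /sub_Lfun_mfun := X0b; rewrite inE.
pose rhoRV : {RV P >-> R} := HB.pack rho (isMeasurableFun.Build _ _ _ _ _ mrho).
pose X0RV : {RV P >-> R} := HB.pack X0 (isMeasurableFun.Build _ _ _ _ _ mX0).
have mle (X : {RV P >-> R}) y : measurable [set w | X w <= y].
  by rewrite -[X in measurable X]setTI; exact: measurable_fun_le.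
(* The margin 1 makes [X0 <= - (M + 1)] a null event; [X0 <= - M] could have positive probability
   through an atom at [- M]. *)
have Q0M s : 0 < s < 1 -> `|quantile P X0 s| <= M + 1.
  move=> /andP[s0 s1]; rewrite ler_norml; apply/andP; split.
    apply: (quantile_ge P X0RV) => //.
    rewrite (_ : P _ = 0)%E; first by rewrite lee_fin ltW.
    apply/negligibleP; first exact: (mle X0RV).
    apply: negligibleS X0M => w /= Xw; apply/negP; rewrite -ltNge.
    by have := ler_norm (- X0 w); rewrite normrN; lra.
  apply: (quantile_le P X0RV) => //.
  rewrite -(setCK [set w | _]) probability_setC; last first.
    exact/measurableC/(mle X0RV).
  rewrite (_ : P _ = 0)%E; first by rewrite sube0 lte_fin.
  apply/negligibleP; first exact/measurableC/(mle X0RV).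
  apply: negligibleS X0M => w /= Xw; apply/negP; rewrite -ltNge.
  by move/negP: Xw; rewrite -ltNge; have := ler_norm (X0 w); lra.
pose g s := quantile P rho (1 - s).
have rho_le0 : P [set w | rho w <= 0] = 0%E.
  have posE : [set w | 0 < rho w] = ~` [set w | rho w <= 0].
    by apply/seteqP; split => w /=; rewrite ltNge => /negP.
  rewrite -(setCK [set w | rho w <= 0]) -posE probability_setC ?rho0 ?subee//.
  by rewrite posE; exact/measurableC/(mle rhoRV).
have g_ge0 s : 0 <= s < 1 -> 0 <= g s.
  move=> /andP[]; rewrite le_eqVlt => /predU1P[<- _|s0 s1].
    (* [quantile P rho 1] is the infimum of the empty set, i.e. [0] *)
    rewrite /g subr0 /quantile (_ : [set y | _] = set0) ?inf0//.
    apply/seteqP; split => // y /=; rewrite ltNge probability_le1//.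
    exact: (mle rhoRV).
  apply: (quantile_ge P rhoRV); first lra.
  by rewrite rho_le0 lee_fin; lra.
have g_ni s t : 0 < s -> s <= t -> t < 1 -> g t <= g s.
  by move=> s0 st t1; apply: (quantile_nondecreasing P rhoRV); lra.
have mg : measurable_fun (`]0, 1[%classic : set R) g.
  rewrite -[g]opprK; apply: measurable_funN.
  apply: nondecreasing_in_measurable; first exact: interval_is_interval.
  move=> s t; rewrite /= !in_itv/= => /andP[s0 _] /andP[_ t1] st.
  by rewrite lerN2 g_ni.
have [s0 s02 qs0] := quantile_lt_of_variance_gt0 P rhoRV Vrho.
have BA : (\int[@lebesgue_measure R]_(s in `[2^-1%R, 1%R[) (g s)%:E
   < \int[@lebesgue_measure R]_(s in `[0%R, 2^-1%R[) (g s)%:E)%E.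
  apply: (integral_nonincreasing_halves_lt _ s0) => //.
    by move=> s /andP[? ?]; apply: g_ge0; lra.
  (* The reflection [s] to [1 - s] turns the strict increase of the quantile between [s0] and
     [1 - s0] into the strict decrease of [g]. *)
  by rewrite /g subKr.
have B0 : (0 <= \int[@lebesgue_measure R]_(s in `[2^-1%R, 1%R[) (g s)%:E)%E.
  apply: integral_ge0 => s /=; rewrite in_itv/= => /andP[? ?].
  by rewrite lee_fin g_ge0//; lra.
set I := ereal_inf _.
(* An extended real below every real is [-oo]; it remains to exhibit, for each [r], an admissible
   step of cost at most [r]. *)
suff I_le r : (I <= r%:E)%E.
  case: I I_le => [x /(_ (x - 1))|/(_ 0)|//]; last by rewrite leye_eq.
  by rewrite lee_fin lerDl oppr_ge0 ler10.
have [k Mk kr] := exists_affine_combination_le _ _ _ (M + 1) r B0 BA.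
have k0 : 0 <= k by rewrite (le_trans _ (ltW Mk)).
apply: le_trans kr; rewrite -(integral_step_quantileM _ _ _ (ltW Mk))//.
apply: ereal_inf_lbound; exists (step_quantile (M + 1) k) => //; split.
  exact: quantile_class_step.
by apply: icx_ge_step_quantile => //; exact: (measurable_quantile P X0RV).
Qed.
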